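(* Let $q$ be an odd prime power, $G=\mathrm{GL}_2(\mathbb{F}_q)$, and let $M\subset G$ be the anisotropic torus. Then $M$ does not detect the mod 2 cohomology of $G$; that is, the restriction map $H^*(G,\mathbb{Z}/2\mathbb{Z})\to H^*(M,\mathbb{Z}/2\mathbb{Z})$ is not injective.
   Context: Identify $\mathbb{F}_{q^2}$ with $\mathbb{F}_q\oplus\mathbb{F}_q$ as an $\mathbb{F}_q$-vector space. For $a\in\mathbb{F}_{q^2}^\times$ the map $x\mapsto a\cdot x$ gives a linear map $M_a\in G$. The anisotropic torus is $M=\{M_a: a\in\mathbb{F}_{q^2}^\times\}$, a cyclic group of order $q^2-1$. A subgroup $G'$ of a finite group $G$ detects the mod 2 cohomology of $G$ if the restriction map $H^*(G,\mathbb{Z}/2\mathbb{Z})\to H^*(G',\mathbb{Z}/2\mathbb{Z})$ is injective. *)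

(* Defs.v *)
From HB Require Import structures.
From mathcomp Require Import all_boot all_order all_fingroup all_algebra.
From mathcomp Require Import all_field zify.

Set Implicit Arguments.
Unset Strict Implicit.
Unset Printing Implicit Defensive.

Import GRing.Theory.
Local Open Scope ring_scope.

(* Cohomology H^n(gT, A) of a finite group gT with coefficients in a finite   *)
(* abelian group A with trivial action, computed by the complex of            *)
(* homogeneous cochains: invariant maps gT^(n+1) -> A, with differential      *)
(*   (d f)(x_0, .., x_(n+1)) = \sum_i (-1)^i f(x_0, .., omit x_i, .., x_(n+1)) *)

Definition simplex (gT : finGroupType) n := {ffun 'I_n.+1 -> gT}.

Definition translate (gT : finGroupType) n (g : gT) (x : simplex gT n) :
  simplex gT n := [ffun i => (g * x i)%g].

Definition face (gT : finGroupType) n (i : 'I_n.+2) (x : simplex gT n.+1) :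
  simplex gT n := [ffun j => x (lift i j)].

Notation cochain gT A n := {ffun simplex gT n -> A}.

Section Cohomology.
Variables (gT : finGroupType) (A : finZmodType).

Definition invariant_cochain n : {pred cochain gT A n} :=
  [pred f : cochain gT A n |
    [forall g : gT, forall x : simplex gT n, f (translate g x) == f x]].

Definition diff n (f : cochain gT A n) : cochain gT A n.+1 :=
  [ffun x => \sum_(i < n.+2) f (face i x) *~ (-1) ^+ i].

Lemma diff_is_zmod_morphism n : zmod_morphism (@diff n).
Proof.
move=> f h; apply/ffunP=> x; rewrite !ffunE -sumrB.
by apply: eq_bigr => i _; rewrite !ffunE mulrzBl.
Qed.

HB.instance Definition _ n :=
  GRing.isZmodMorphism.Build (cochain gT A n) (cochain gT A n.+1) (@diff n)
    (@diff_is_zmod_morphism n).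

Lemma face_face n (i : 'I_n.+3) (j : 'I_n.+2) (i' : 'I_n.+3) (j' : 'I_n.+2)
    (x : simplex gT n.+2) :
  (i <= j)%N -> i' = j.+1 :> nat -> j' = i :> nat ->
  face j (face i x) = face j' (face i' x).
Proof.
move=> le_ij Ei' Ej'; apply/ffunP=> k; rewrite !ffunE; congr (x _).
apply: val_inj; rewrite /= Ei' Ej' /bump; move: (nat_of_ord k) => m; lia.
Qed.

Lemma diff_diff n (f : cochain gT A n) : diff (diff f) = 0.
Proof.
apply/ffunP=> x; rewrite !ffunE.
pose F (p : 'I_n.+3 * 'I_n.+2) :=
  f (face p.2 (face p.1 x)) *~ ((-1) ^+ p.2 * (-1) ^+ p.1).
rewrite [LHS](_ : _ = \sum_p F p); last first.
  rewrite -(pair_bigA _ (fun i j => F (i, j))) /=; apply: eq_bigr => i _.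
  by rewrite ffunE mulrz_suml; apply: eq_bigr => j _; rewrite /F mulrzA.
rewrite (bigID (fun p : 'I_n.+3 * 'I_n.+2 => (p.1 <= p.2)%N)) /=.
pose h (p : 'I_n.+3 * 'I_n.+2) : 'I_n.+3 * 'I_n.+2 :=
  (inord p.2.+1, inord p.1).
pose h' (p : 'I_n.+3 * 'I_n.+2) : 'I_n.+3 * 'I_n.+2 :=
  (inord p.2, inord p.1.-1).
rewrite [X in _ + X](reindex_onto h h') /=; last first.
  move=> [i j] /=; rewrite -ltnNge => lt_ji; have [Hi Hj] := (ltn_ord i, ltn_ord j).
  by congr pair; apply: val_inj; rewrite /= !inordK //=; lia.
rewrite [X in _ + X](eq_bigl (fun p : 'I_n.+3 * 'I_n.+2 => (p.1 <= p.2)%N)); last first.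
  move=> [i j] /=; have [Hi Hj] := (ltn_ord i, ltn_ord j).
  case: (leqP i j) => ij.
    by rewrite xpair_eqE -!val_eqE /= !inordK /= ?inordK ?eqxx //=; lia.
  apply/negbTE/negP=> /andP[nle]; rewrite xpair_eqE -!val_eqE /=.
  have := ltn_ord (@inord n.+1 i); move: nle.
  rewrite (@inordK n.+2 j.+1) //; set v := nat_of_ord (@inord n.+1 i).
  move=> nle lt_v; rewrite inordK => [/andP[/eqP Ev _]|]; lia.
rewrite -big_split big1 //= => -[i j] /= le_ij.
have [Hi Hj] := (ltn_ord i, ltn_ord j).
rewrite /F /h /= (@face_face _ i j (inord j.+1) (inord i)) ?inordK //; try lia.
by rewrite -mulrzDr exprS mulN1r mulrN mulrC subrr mulr0z.
Qed.

Lemma invariant_zmod_closed n : zmod_closed (@invariant_cochain n).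
Proof.
split=> [|f h /forallP If /forallP Ih].
  by apply/forallP=> g; apply/forallP=> x; rewrite !ffunE.
apply/forallP=> g; apply/forallP=> x; rewrite !ffunE.
by rewrite (eqP (forallP (If g) x)) (eqP (forallP (Ih g) x)).
Qed.

HB.instance Definition _ n :=
  GRing.isZmodClosed.Build (cochain gT A n) (@invariant_cochain n)
    (@invariant_zmod_closed n).

Definition cocycle_pred n : {pred cochain gT A n} :=
  [pred f | (f \in @invariant_cochain n) && (diff f == 0)].

Lemma cocycle_zmod_closed n : zmod_closed (@cocycle_pred n).
Proof.
split=> [|f h]; first by apply/andP; split; rewrite ?rpred0 ?raddf0.
move=> /andP[If df] /andP[Ih dh]; apply/andP; split.
  exact: rpredB.
by rewrite raddfB /= (eqP (df : diff f == 0)) (eqP (dh : diff h == 0)) subr0.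
Qed.

HB.instance Definition _ n :=
  GRing.isZmodClosed.Build (cochain gT A n) (@cocycle_pred n)
    (@cocycle_zmod_closed n).

Record cocycle n : predArgType :=
  Cocycle { cocycle_val :> cochain gT A n;
            cocycle_valP : cocycle_val \in @cocycle_pred n }.

HB.instance Definition _ n := [isSub for @cocycle_val n].
HB.instance Definition _ n := [Choice of cocycle n by <:].
HB.instance Definition _ n := [SubChoice_isSubZmodule of cocycle n by <:].

Definition coboundary n : {pred cocycle n} :=
  match n return {pred cocycle n} with
  | 0 => pred1 0
  | m.+1 => [pred f : cocycle m.+1 |
      [exists h : cochain gT A m,
        (h \in @invariant_cochain m) && (val f == diff h)]]
  end.

Lemma coboundary_zmod_closed n : zmod_closed (@coboundary n).
Proof.
case: n => [|n].
  split=> [|f h]; first exact: eqxx.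
  move=> f0 h0; rewrite (eqP (f0 : f == 0)) (eqP (h0 : h == 0)) subrr.
  exact: eqxx.
split=> [|f h].
  by apply/existsP; exists 0; rewrite rpred0 [diff 0]raddf0 raddf0 eqxx.
move=> /existsP[a /andP[Ia /eqP fa]] /existsP[b /andP[Ib /eqP hb]].
apply/existsP; exists (a - b); rewrite rpredB //=.
have -> : diff (a - b) = diff a - diff b by exact: raddfB.
by rewrite -fa -hb; exact: eqxx.
Qed.

HB.instance Definition _ n :=
  GRing.isZmodClosed.Build (cocycle n) (@coboundary n)
    (@coboundary_zmod_closed n).

Lemma diff_coboundary n (h : cochain gT A n) :
  h \in @invariant_cochain n -> diff h \in @cocycle_pred n.+1.
Proof.
move=> /forallP Ih; rewrite !unfold_in /= diff_diff eqxx andbT.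
apply/forallP=> g; apply/forallP=> x; rewrite !ffunE; apply/eqP.
apply: eq_bigr => i _; congr (_ *~ _).
rewrite -(eqP (forallP (Ih g) (face i x))); congr (h _).
by apply/ffunP=> j; rewrite !ffunE.
Qed.

Definition cohomology n := Quotient.quot (@coboundary n).
HB.instance Definition _ n := GRing.Zmodule.on (cohomology n).

End Cohomology.

(* Restriction to a subgroup H, viewed as the group [subg H].                 *)
Section Restriction.
Variables (gT : finGroupType) (H : {group gT}) (A : finZmodType).

Definition res_cochain n (f : cochain gT A n) : cochain (subg_of H) A n :=
  [ffun y : simplex (subg_of H) n => f [ffun i => sgval (y i)]].

Lemma res_cochain_is_zmod_morphism n : zmod_morphism (@res_cochain n).
Proof. by move=> f h; apply/ffunP=> y; rewrite !ffunE. Qed.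

HB.instance Definition _ n :=
  GRing.isZmodMorphism.Build (cochain gT A n) (cochain (subg_of H) A n)
    (@res_cochain n) (@res_cochain_is_zmod_morphism n).

Lemma res_invariant n (f : cochain gT A n) :
  f \in @invariant_cochain gT A n ->
  res_cochain f \in @invariant_cochain (subg_of H) A n.
Proof.
move=> /forallP If; apply/forallP=> g; apply/forallP=> y; rewrite !ffunE.
rewrite -(eqP (forallP (If (sgval g)) [ffun i => sgval (y i)])).
apply/eqP; congr (f _).
by apply/ffunP=> i; rewrite !ffunE.
Qed.

Lemma res_diff n (f : cochain gT A n) :
  res_cochain (diff f) = diff (res_cochain f).
Proof.
apply/ffunP=> y; rewrite !ffunE; apply: eq_bigr => i _; rewrite ffunE.
by congr (f _ *~ _); apply/ffunP=> j; rewrite !ffunE.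
Qed.

Lemma res_cocycle_subproof n (z : cocycle gT A n) :
  res_cochain z \in @cocycle_pred (subg_of H) A n.
Proof.
have /andP[Iz dz] := cocycle_valP z; apply/andP; split.
  exact: res_invariant.
by rewrite -res_diff (eqP (dz : diff z == 0)) raddf0.
Qed.

Definition res_cocycle n (z : cocycle gT A n) : cocycle (subg_of H) A n :=
  Cocycle (res_cocycle_subproof z).

Lemma res_cocycleB n : {morph @res_cocycle n : y z / y - z}.
Proof. by move=> y z; apply: val_inj; exact: raddfB. Qed.

Lemma res_coboundary n (z : cocycle gT A n) :
  z \in @coboundary gT A n ->
  res_cocycle z \in @coboundary (subg_of H) A n.
Proof.
case: n z => [|n] z.
  move=> z0; rewrite (eqP (z0 : z == 0)); apply/eqP.
  by apply: val_inj; exact: raddf0.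
move=> /existsP[h /andP[Ih /eqP zh]]; apply/existsP; exists (res_cochain h).
by rewrite res_invariant //= -res_diff -zh.
Qed.

Definition res n (c : cohomology gT A n) : cohomology (subg_of H) A n :=
  \pi_(Quotient.quot (@coboundary (subg_of H) A n))%qT
    (res_cocycle (generic_quotient.repr c)).

(* [res] is induced by restriction of cocycles.                               *)
Lemma res_pi n (z : cocycle gT A n) :
  res (\pi_(Quotient.quot (@coboundary gT A n))%qT z) =
  \pi_(Quotient.quot (@coboundary (subg_of H) A n))%qT (res_cocycle z).
Proof.
apply/eqP; rewrite -Quotient.idealrBE -res_cocycleB res_coboundary //.
by rewrite Quotient.idealrBE reprK.
Qed.

Lemma res_is_zmod_morphism n : zmod_morphism (@res n).
Proof.
move=> c d; rewrite -[c]reprK -[d]reprK !res_pi -!raddfB /= res_pi.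
by rewrite res_cocycleB.
Qed.

HB.instance Definition _ n :=
  GRing.isZmodMorphism.Build (cohomology gT A n) (cohomology (subg_of H) A n)
    (@res n) (@res_is_zmod_morphism n).

End Restriction.

(* H^*(gT, Z/2) is graded and restriction preserves degree, so injectivity on *)
(* H^* means injectivity in every degree.                                     *)
Definition detects_mod2_cohomology (gT : finGroupType) (H : {group gT}) :=
  forall n, injective (@res gT H 'F_2 n).

(* [phi], meant to be bijective, identifies the quadratic extension L of F    *)
(* with F + F; [finvect_type L] is L itself, as a finite type.                *)
Section Torus.
Variables (F : finFieldType) (L : fieldExtType F).
Variable phi : {linear L -> 'cV[F]_2}.

Definition anisotropic_torus : {set {'GL_2[F]}} :=
  [set g : {'GL_2[F]} | [exists a : finvect_type L,
    (a != 0) && [forall x : finvect_type L,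
                  phi ((a : L) * (x : L)) == GLval g *m phi x]]].

Lemma anisotropic_torus_group_set : group_set anisotropic_torus.
Proof.
apply/group_setP; split=> [|g h].
  rewrite inE; apply/existsP; exists 1; rewrite oner_eq0.
  by apply/forallP=> x; rewrite mul1r mul1mx.
rewrite !inE => /existsP[a /andP[a0 /forallP Ha]] /existsP[b /andP[b0 /forallP Hb]].
apply/existsP; exists (a * b); rewrite mulf_neq0 //=; apply/forallP=> x.
by rewrite -mulrA (eqP (Ha _)) (eqP (Hb _)) mulmxA.
Qed.

Canonical anisotropic_torus_group := Group anisotropic_torus_group_set.

End Torus.

(* Main.v *)
Require Import Defs.
From HB Require Import structures.
From mathcomp Require Import all_boot all_order all_fingroup all_algebra.
From mathcomp Require Import all_solvable all_field ring zify.

(** The class that the torus misses lives in degree 2: it is the obstruction to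
    taking square roots of the determinant multiplicatively.

    Write q for #|F|.  Every nonzero c in F has a square root in the quadratic
    extension L ([base_sqrt]), so squaring defines a central extension
      1 -> {1, -1} -> {x in L^* | x^2 in F} -> F^* -> 1.
    Pull it back to G = GL_2(F) along det.  A choice s(g) of a square root of
    det g is a section of the pulled back extension, and the signs
    s(g) s(h) / s(gh) form a 2-cocycle.  This class is trivial on a subgroup H
    exactly when some multiplicative t : H -> L^* satisfies t^2 = det on H.

    The class of G is nonzero: diag(-1, 1) is an involution of determinant -1,
    and a multiplicative t would give -1 = t(g)^2 = t(g^2) = t(1) = 1, which
    fails as q is odd ([sqrt_cocycle_not_coboundary]).

    The class of the torus M is zero: M is cyclic of order q^2 - 1, the order
    of L^* ([torus_cyclic]).  If g generates M and y in L is a square root of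
    det g, then the order of y divides that of g, so g^k |-> y^k is well
    defined, and its square is det ([torus_det_sqr]).

    [sqrt_class_undetected] assembles these facts for an arbitrary subgroup of
    a finite group. *)

Set Implicit Arguments.
Unset Strict Implicit.
Unset Printing Implicit Defensive.

Import GRing.Theory.
Local Open Scope ring_scope.

(** * Signs in a field as elements of Z/2 *)

Lemma mulrz_sign_F2 (a : 'F_2) n : a *~ (-1) ^+ n = a.
Proof.
rewrite -signr_odd; case: (odd n); rewrite ?mulr1z // mulrN1z.
by case: a => -[|[|//]] ?; apply: val_inj.
Qed.

Lemma addrr_F2 (a : 'F_2) : a + a = 0.
Proof. by case: a => -[|[|//]] ?; apply: val_inj. Qed.

(** The shape in which the cocycle identity appears once the four faces of a
    3-simplex are summed without signs: even faces against odd faces. *)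
Lemma addr4_swap (V : zmodType) (a b c d : V) :
  a + c = b + d -> a + (b + (c + d)) = (b + d) + (b + d).
Proof. by move=> ac; rewrite (addrCA b) (addrA a) ac. Qed.

Section SignBit.
Variable K : fieldType.
Implicit Types u v : K.

(** Meant for u = 1 or u = -1, where it is the isomorphism {1, -1} = Z/2 (and
    the trivial map in characteristic 2). *)
Definition sign_bit u : 'F_2 := (u != 1)%:R.

Lemma sign_bitM u v : u ^+ 2 = 1 -> v ^+ 2 = 1 ->
  sign_bit (u * v) = sign_bit u + sign_bit v.
Proof.
rewrite /sign_bit => /eqP; rewrite sqrf_eq1 => /pred2P[] -> /eqP.
  by rewrite mul1r eqxx add0r.
rewrite sqrf_eq1 => /pred2P[] ->; first by rewrite mulr1 eqxx addr0.
by rewrite mulrNN mulr1 eqxx addrr_F2.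
Qed.

Lemma sign_bit_inj u v : u ^+ 2 = 1 -> v ^+ 2 = 1 ->
  sign_bit u = sign_bit v -> u = v.
Proof.
move=> u2 v2; rewrite /sign_bit.
have [->|u1] := eqVneq u 1; have [->|v1] := eqVneq v 1 => // _.
move/eqP: u2; move/eqP: v2; rewrite !sqrf_eq1 (negPf u1) (negPf v1) /=.
by move=> /eqP-> /eqP->.
Qed.

End SignBit.

(** * The square root class *)

Local Notation vertex k := (@Ordinal 3 k isT).

Section SquareRootClass.
Variables (K : fieldType) (gT : finGroupType).
Implicit Types (s t : gT -> K) (g : gT).

(** If s^2 is multiplicative then s(g) s(h) and s(gh) differ by a sign: this is
    how the condition that s is a set-theoretic section of an extension by
    {1, -1} is expressed without building the extension. *)
Definition mult_up_to_sign s :=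
  (forall g, s g != 0) /\
  {morph (fun g => s g ^+ 2) : g h / (g * h)%g >-> g * h}.

(** The inhomogeneous cocycle s(g) s(h) / s(gh) of the extension, written on the
    homogeneous simplex (x, y, z) with g = x^-1 y and h = y^-1 z. *)
Definition discrepancy s (x y z : gT) :=
  s (x^-1 * y)%g * s (y^-1 * z)%g / s (x^-1 * z)%g.

Definition sqrt_cochain s : cochain gT 'F_2 2 :=
  [ffun x : simplex gT 2%N =>
     sign_bit (discrepancy s (x (vertex 0)) (x (vertex 1)) (x (vertex 2)))].

Lemma discrepancy_sqr s x y z :
  mult_up_to_sign s -> discrepancy s x y z ^+ 2 = 1.
Proof.
case=> s0 sM; rewrite /discrepancy expr_div_n exprMn -sM mulgA mulgK.
by rewrite divff // expf_neq0.
Qed.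

(** In the product of the discrepancies of the two even faces of a 3-simplex,
    and of the two odd ones, the edges cancel down to the same expression
    s(01) s(12) s(23) / s(03); additivity of [sign_bit] then gives d = 0. *)
Lemma sqrt_cochain_cocycle s :
  mult_up_to_sign s -> sqrt_cochain s \in @cocycle_pred gT 'F_2 2.
Proof.
move=> sP; have [s0 _] := sP; apply/andP; split.
  apply/forallP=> g; apply/forallP=> x; rewrite !ffunE /discrepancy.
  have E a b : ((g * a)^-1 * (g * b) = a^-1 * b)%g.
    by rewrite invMg mulgA mulgKV.
  by rewrite !E.
apply/eqP/ffunP=> x; rewrite !ffunE.
under eq_bigr do rewrite mulrz_sign_F2 !ffunE.
pose y k := x (inord k).
have xE i : x i = y i by rewrite /y inord_val.
rewrite !big_ord_recl big_ord0 !xE /= /bump /= !add1n !add0n.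
have sD := discrepancy_sqr _ _ _ sP.
have : sign_bit (discrepancy s (y 1%N) (y 2%N) (y 3%N) *
                 discrepancy s (y 0%N) (y 1%N) (y 3%N)) =
       sign_bit (discrepancy s (y 0%N) (y 2%N) (y 3%N) *
                 discrepancy s (y 0%N) (y 1%N) (y 2%N)).
  by congr sign_bit; rewrite /discrepancy; field; rewrite !s0.
have dM a b c a' b' c' :
    sign_bit (discrepancy s a b c * discrepancy s a' b' c') =
      sign_bit (discrepancy s a b c) + sign_bit (discrepancy s a' b' c').
  exact: sign_bitM.
by rewrite !dM addr0 => /addr4_swap->; exact: addrr_F2.
Qed.

Definition sqrt_cocycle s (sP : mult_up_to_sign s) : cocycle gT 'F_2 2 :=
  Cocycle (sqrt_cochain_cocycle sP).

(** Dividing s by the multiplicative square root t leaves a sign r = s / t,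
    and the discrepancy of s is that of r, i.e. the coboundary of r. *)
Lemma sqrt_cocycle_coboundary s t (sP : mult_up_to_sign s) :
    {morph t : g h / (g * h)%g >-> g * h} -> (forall g, t g ^+ 2 = s g ^+ 2) ->
  sqrt_cocycle sP \in @coboundary gT 'F_2 2.
Proof.
move=> tM ts; have [s0 _] := sP.
have t0 g : t g != 0 by rewrite -sqrf_eq0 ts sqrf_eq0.
pose r g := s g / t g.
have r2 g : r g ^+ 2 = 1 by rewrite expr_div_n ts divff // expf_neq0.
have rM a b c :
    sign_bit (r a * (r b * r c)) =
      sign_bit (r a) + (sign_bit (r b) + sign_bit (r c)).
  have bc2 : (r b * r c) ^+ 2 = 1 by rewrite exprMn !r2 mulr1.
  by rewrite (sign_bitM (r2 a) bc2) (sign_bitM (r2 b) (r2 c)).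
apply/existsP; exists
  [ffun x : simplex gT 1%N => sign_bit (r ((x ord0)^-1 * x ord_max)%g)].
apply/andP; split.
  apply/forallP=> g; apply/forallP=> x; rewrite !ffunE.
  by rewrite invMg mulgA mulgKV.
apply/eqP/ffunP=> x; rewrite !ffunE.
under eq_bigr do rewrite mulrz_sign_F2 !ffunE.
pose y k := x (inord k).
have xE i : x i = y i by rewrite /y inord_val.
rewrite !big_ord_recl big_ord0 !xE /= /bump /= !add1n !add0n addr0.
rewrite -rM; congr sign_bit.
have tE : t ((y 0%N)^-1 * y 2%N)%g =
    t ((y 0%N)^-1 * y 1%N)%g * t ((y 1%N)^-1 * y 2%N)%g.
  by rewrite -tM mulgA mulgK.
(* The middle edge divides in the discrepancy, but the unsigned sum multiplies
   by its sign; the two agree because a sign is its own inverse. *)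
have -> : r ((y 0%N)^-1 * y 2%N)%g = (r ((y 0%N)^-1 * y 2%N)%g)^-1.
  set u := r _; rewrite -[RHS]mul1r -(r2 ((y 0%N)^-1 * y 2%N)%g) expr2 mulfK //.
  by rewrite mulf_neq0 ?invr_eq0.
by rewrite /r /discrepancy tE; field; rewrite ?s0 ?t0.
Qed.

(** A cochain h of degree 1 sees an involution k twice: on the simplex
    (1, k, 1) the faces (k, 1) and (1, k) are translates of each other, so they
    cancel mod 2 and (dh)(1, k, 1) = h(1, 1) does not depend on k.  The square
    root cocycle takes there the sign s(k)^2 / s(1), which does depend on k
    as soon as s^2 does. *)
Lemma sqrt_cocycle_not_coboundary s (sP : mult_up_to_sign s) g :
    (g * g = 1)%g -> s g ^+ 2 != s 1%g ^+ 2 ->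
  sqrt_cocycle sP \notin @coboundary gT 'F_2 2.
Proof.
move=> gg1; apply: contra => /existsP[h /andP[/forallP hI /eqP /= fE]].
have [s0 _] := sP.
pose edge a b : simplex gT 1%N := [ffun i => if i == ord0 then a else b].
have kV (k : gT) : (k * k = 1)%g -> (k^-1 = k)%g.
  by move=> kk1; apply: (mulgI k); rewrite mulgV.
have fgg k : (k * k = 1)%g -> sign_bit (s k ^+ 2 / s 1%g) = h (edge 1 1)%g.
  move=> kk1.
  pose x : simplex gT 2%N := [ffun i => if i == vertex 1 then k else 1%g].
  have := congr1 (fun f : cochain gT 'F_2 2 => f x) fE; rewrite !ffunE /=.
  rewrite /discrepancy !invg1 !mul1g mulg1 kV // -expr2 => ->.
  under eq_bigr do rewrite mulrz_sign_F2.
  rewrite !big_ord_recl big_ord0 addr0.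
  have -> : face ord0 x = translate k (edge 1 k)%g.
    apply/ffunP=> i; rewrite !ffunE -val_eqE /=.
    by case: i => -[|[|//]] ? /=; rewrite ?kk1 ?mulg1.
  have -> : face (lift ord0 ord0) x = edge 1%g 1%g.
    by apply/ffunP=> i; rewrite !ffunE -val_eqE /=; case: i => -[|[|//]].
  have -> : face (lift ord0 (lift ord0 ord0)) x = edge 1%g k.
    by apply/ffunP=> i; rewrite !ffunE -val_eqE /=; case: i => -[|[|//]].
  by rewrite (eqP (forallP (hI k) _)) addrCA addrr_F2 addr0.
have sg2 k : (k * k = 1)%g -> (s k ^+ 2 / s 1%g) ^+ 2 = 1.
  move=> kk1; have := discrepancy_sqr 1%g k 1%g sP; rewrite /discrepancy.
  by rewrite invg1 !mul1g mulg1 kV // -expr2.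
(* The identity satisfies k * k = 1 too: compare k = g with k = 1. *)
have : s g ^+ 2 / s 1%g = s 1%g ^+ 2 / s 1%g.
  by apply: sign_bit_inj; rewrite ?sg2 ?fgg ?mulg1.
by move/(divIf (s0 _)) ->.
Qed.

End SquareRootClass.

Lemma res_sqrt_cochain (K : fieldType) (gT : finGroupType) (H : {group gT})
    (s : gT -> K) :
  res_cochain H (sqrt_cochain s) = sqrt_cochain (s \o @sgval gT H).
Proof. by apply/ffunP=> x; rewrite !ffunE. Qed.

(** The restriction of the square root class of s to H is the square root class
    of the restriction of s, which t trivialises; the involution g keeps the
    class of the whole group from vanishing. *)
Lemma sqrt_class_undetected (K : fieldType) (gT : finGroupType) (H : {group gT})
    (s t : gT -> K) (g : gT) :
    mult_up_to_sign s ->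
    {in H &, {morph t : x y / (x * y)%g >-> x * y}} ->
    {in H, forall x, t x ^+ 2 = s x ^+ 2} ->
    (g * g = 1)%g -> s g ^+ 2 != s 1%g ^+ 2 ->
  ~ detects_mod2_cohomology H.
Proof.
move=> sP tM ts gg1 sg1 /(_ 2) res_inj.
have sHP : mult_up_to_sign (s \o @sgval gT H).
  by case: sP => s0 sM; split=> [x | x y] /=; rewrite ?sM.
have /negP[] := sqrt_cocycle_not_coboundary sP gg1 sg1.
rewrite -[sqrt_cocycle sP]subr0 Quotient.idealrBE; apply/eqP/res_inj.
rewrite !res_pi; apply/eqP; rewrite -Quotient.idealrBE -res_cocycleB subr0.
suff -> : res_cocycle H (sqrt_cocycle sP) = sqrt_cocycle sHP.
  apply: (@sqrt_cocycle_coboundary _ _ _ (t \o @sgval gT H)) => [x y | x] /=.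
    by rewrite tM ?subgP.
  by rewrite ts ?subgP.
by apply: val_inj; apply: res_sqrt_cochain.
Qed.

(** * Square roots in finite fields *)

(** Euler's criterion: in the cyclic group of units, of even order, the
    elements killed by half the order are the even powers of a generator. *)
Lemma finField_sqrt (K : finFieldType) (x : K) :
  odd #|K| -> x ^+ (#|K|.-1)./2 = 1 -> exists y, y ^+ 2 = x.
Proof.
move=> oddK xN; have K_gt1 := finNzRing_gt1 K.
have xU : x \is a GRing.unit.
  rewrite unitfE; apply: contra_eq_neq xN => ->.
  rewrite expr0n; have /negPf-> : (#|K|.-1)./2 != 0%N; last first.
    by rewrite eq_sym oner_neq0.
  by move: oddK K_gt1; case: #|_| => [|[|[|n]]].
have [u uE] := cyclicP (field_unit_group_cyclic [group of [set: {unit K}]]).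
have ou : #[u]%g = #|K|.-1 by rewrite orderE -uE card_finField_unit.
have /cycleP[k xE] : FinRing.unit K xU \in <[u]>%g by rewrite -uE inE.
have {}xE : x = val u ^+ k by rewrite -FinRing.val_unitX -xE.
have : (u ^+ (k * (#|K|.-1)./2) == 1)%g.
  by rewrite -val_eqE /= FinRing.val_unitX exprM -xE xN.
rewrite -order_dvdn ou => dvd_k.
have N2 : (#|K|.-1 = 2 * (#|K|.-1)./2)%N.
  by rewrite mul2n even_halfK // -subn1 oddB ?oddK // ltnW.
have N_gt0 : (0 < (#|K|.-1)./2)%N by rewrite -double_gt0 -mul2n -N2 ltn_predRL.
move: dvd_k; rewrite {1}N2 dvdn_pmul2r // => /dvdnP[j k2].
by exists (val u ^+ j); rewrite xE k2 exprM.
Qed.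

(** Otherwise 1 would have order 2 in the additive group, of odd order. *)
Lemma odd_finField_neqN1 (K : finFieldType) : odd #|K| -> (-1 : K) != 1.
Proof.
move=> oddK; apply/eqP=> N1; suff : (2 %| #|K|)%N by rewrite dvdn2 oddK.
have dvd1 : (#[1%R : K]%g %| #|K|)%N by rewrite -cardsT order_dvdG ?inE.
suff <- : #[1%R : K]%g = 2%N by [].
apply: nt_prime_order => //; last by exact: oner_neq0.
by rewrite expgS expg1 -[X in (X * _)%g]N1; exact: addNr.
Qed.

(** * The anisotropic torus *)

Lemma mx_of_linear (F : fieldType) n (f : {linear 'cV[F]_n -> 'cV[F]_n}) :
  exists A : 'M[F]_n, forall v, f v = A *m v.
Proof.
exists (\matrix_(i, j) f (delta_mx j 0) i 0) => v; apply/colP=> i.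
rewrite {1}(matrix_sum_delta v) linear_sum summxE !mxE; apply: eq_bigr => j _.
by rewrite big_ord1 linearZ_LR !mxE mulrC.
Qed.

Section TorusStructure.
Variables (F : finFieldType) (L : fieldExtType F).
Variable phi : {linear L -> 'cV[F]_2}.
Hypothesis phi_bij : bijective phi.
Local Notation K := (finvect_type L).
Local Notation T := (anisotropic_torus phi).

Lemma card_quadratic_ext : #|K| = (#|F| ^ 2)%N.
Proof.
by rewrite (bij_eq_card (phi_bij : bijective (phi : K -> 'cV[F]_2))) card_mx.
Qed.

Lemma torusP (g : {'GL_2[F]}) : reflect
  (exists2 a : L, a != 0 & forall x, phi (a * x) = GLval g *m phi x)
  (g \in T).
Proof.
rewrite inE; apply: (iffP existsP) => [[a /andP[a0 /forallP H]] | [a a0 H]].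
  by exists a => // x; apply/eqP/(H x).
by exists a; rewrite a0; apply/forallP=> x; apply/eqP/H.
Qed.

(** The matrix is that of multiplication by a, transported along phi. It is
    only remembered through the image of 1, which determines a. *)
Lemma torus_element (a : L) : a != 0 ->
  exists2 g, g \in T & GLval g *m phi 1 = phi a.
Proof.
move=> a0; have [psi psiK phiK] := phi_bij.
have psiL : linear psi.
  by move=> c u v; apply: (can_inj psiK); rewrite linearP !phiK.
pose f v := phi (a * psi v).
have fL : linear f by move=> c u v; rewrite /f psiL mulrDr -scalerAr linearP.
pose fM := GRing.isLinear.Build F _ _ _ f fL.
pose fl : {linear 'cV[F]_2 -> 'cV[F]_2} := HB.pack f fM.
have [A fA] := mx_of_linear fl.
have AE x : A *m phi x = phi (a * x) by rewrite -fA /= /f psiK.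
have A_unit : A \in unitmx.
  rewrite -unitmx_tr -row_free_unit; apply/inj_row_free=> v vA.
  have : A *m v^T = 0 by rewrite -[A]trmxK -trmx_mul vA trmx0.
  rewrite -[v^T]phiK AE -[0](raddf0 phi) => /(can_inj psiK)/eqP.
  rewrite mulf_eq0 (negPf a0) /= => /eqP v0.
  by rewrite -[v]trmxK -[v^T]phiK v0 raddf0 trmx0.
exists (insubd (1%g : {'GL_2[F]}) A); last first.
  by rewrite -[GLval _]/(val _) insubdK // AE mulr1.
apply/torusP; exists a => // x.
by rewrite -[GLval _]/(val _) insubdK // AE.
Qed.

(** The map sending M_a to a embeds the torus in the units of a field, hence it
    is cyclic, and it reaches every unit, hence the order. *)
Lemma torus_cyclic : exists2 g, T = <[g]>%g & #[g]%g = #|K|.-1.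
Proof.
have [psi psiK phiK] := phi_bij.
pose a (g : {'GL_2[F]}) : K := psi (GLval g *m phi 1).
have aP g : g \in T -> a g != 0 /\ forall x, phi (a g * x) = GLval g *m phi x.
  case/torusP=> b b0 bE; suff -> : a g = b by [].
  by rewrite /a -bE psiK mulr1.
have aM : {in T &, {morph a : g h / (g * h)%g >-> g * h}}.
  move=> g h gT hT; apply: (can_inj psiK); rewrite (aP g gT).2.
  by rewrite /a !phiK mulmxA.
have a_inj : {in T &, injective a}.
  move=> g h gT hT gh; apply/val_inj/trmx_inj/row_matrixP=> i.
  rewrite -!tr_col !colE -[delta_mx _ _]phiK.
  by rewrite -(aP g gT).2 -(aP h hT).2 gh.
have : cyclic (anisotropic_torus_group phi).
  apply: (@field_mul_group_cyclic _ _ K a) => // g gT; split=> [ag|->].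
    apply: a_inj; rewrite ?group1 // ag /a mul1mx psiK //.
  by rewrite /a mul1mx psiK.
case/cyclicP=> g gE; exists g => //.
rewrite orderE -gE -(card_in_imset a_inj).
rewrite -(cardsC1 (0 : K)); congr #|pred_of_set _|; apply/setP=> x.
rewrite !inE; apply/imsetP/idP=> [[h hT ->] | /torus_element[h hT hx]].
  by have [] := aP h hT.
by exists h; rewrite // /a hx psiK.
Qed.

(** For c in F, c^(q - 1) = 1, and (q^2 - 1) / 2 = (q - 1) (q + 1) / 2 is a
    multiple of q - 1, so Euler's criterion holds for c in L. *)
Lemma base_sqrt (c : F) : odd #|F| -> c != 0 -> exists y : K, y ^+ 2 = c%:A.
Proof.
move=> oddF c0; apply: finField_sqrt.
  by rewrite card_quadratic_ext oddX oddF.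
rewrite -in_algE -rmorphXn card_quadratic_ext.
have -> : ((#|F| ^ 2).-1./2 = #|F|.-1 * #|F|.+1./2)%N.
  move: oddF; case: #|F| => // n; rewrite oddS => even_n.
  rewrite -[n]odd_double_half (negPf even_n) add0n; set m := n./2; nia.
rewrite exprM; suff -> : c ^+ #|F|.-1 = 1 by rewrite expr1n rmorph1.
apply: (mulfI c0); rewrite mulr1 -exprS prednK ?expf_card //.
by apply/card_gt0P; exists c.
Qed.

(** The generator g of the torus goes to a square root y of its determinant.
    This extends to a morphism because y^(#|L| - 1) = 1 whatever y is, and g
    has order exactly #|L| - 1. *)
Lemma torus_det_sqr : odd #|F| ->
  exists2 t : {'GL_2[F]} -> K,
    {in T &, {morph t : g h / (g * h)%g >-> g * h}} &
    {in T, forall g, t g ^+ 2 = (\det (GLval g))%:A}.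
Proof.
move=> oddF; have [g TE og] := torus_cyclic.
have [y yE] := base_sqrt oddF (GL_det g).
have yU : y \is a GRing.unit.
  by rewrite unitfE -sqrf_eq0 yE scaler_eq0 negb_or GL_det oner_neq0.
pose u := FinRing.unit K yU.
have dvd_u : (#[u]%g %| #[g]%g)%N.
  by rewrite og -card_finField_unit order_dvdG ?inE.
exists (fun h => val (eltm dvd_u h)) => [h k|h]; rewrite TE.
  by move=> hT kT; rewrite eltmM.
case/cycleP=> i ->; rewrite eltmE FinRing.val_unitX /= exprAC yE.
by rewrite -in_algE -rmorphXn; congr (_%:A); elim: i => [|i IH];
  rewrite ?det1 // expgS exprS IH -det_mulmx.
Qed.

End TorusStructure.

(** * An involution of determinant -1 *)

Lemma GL2_det_N1_involution (F : finFieldType) :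
  exists2 g : {'GL_2[F]}, (g * g = 1)%g & \det (GLval g) = -1.
Proof.
pose d : 'rV[F]_2 := \row_j (if j == 0 then -1 else 1).
have dd : diag_mx d *m diag_mx d = 1%:M.
  rewrite mulmx_diag -diag_const_mx; congr diag_mx; apply/rowP=> j.
  by rewrite !mxE; case: eqP; rewrite ?mulrNN mulr1.
have dU : diag_mx d \in unitmx by case/mulmx1_unit: dd.
have gE : GLval (insubd (1%g : {'GL_2[F]}) (diag_mx d)) = diag_mx d.
  exact: insubdK.
exists (insubd (1%g : {'GL_2[F]}) (diag_mx d)).
  by apply: val_inj; rewrite [LHS]GL_MxE gE.
by rewrite gE det_diag !big_ord_recl big_ord0 !mxE /= !mulr1.
Qed.

Theorem theorem12 (F : finFieldType) (L : fieldExtType F)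
    (phi : {linear L -> 'cV[F]_2}) (oddq : odd #|F|) (phi_bij : bijective phi) :
  ~ detects_mod2_cohomology (anisotropic_torus_group phi).
Proof.
have [t tM t2] := torus_det_sqr phi_bij oddq.
have [s sE] : exists s : {'GL_2[F]} -> finvect_type L,
    forall g, s g ^+ 2 = (\det (GLval g))%:A.
  apply: (@fin_all_exists {'GL_2[F]} (fun=> finvect_type L)
    (fun g y => y ^+ 2 = (\det (GLval g))%:A)) => g.
  by have := base_sqrt phi_bij oddq (GL_det g).
have [g gg1 det_g] := GL2_det_N1_involution F.
have sP : mult_up_to_sign s.
  split=> [h | h k]; last by rewrite !sE det_mulmx -in_algE rmorphM.
  by rewrite -sqrf_eq0 sE scaler_eq0 negb_or GL_det oner_neq0.
apply: (sqrt_class_undetected sP tM _ gg1) => [h hT|].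
  by rewrite t2 // sE.
rewrite !sE det_g det1 scaleN1r scale1r.
apply: (@odd_finField_neqN1 (finvect_type L)).
by rewrite (card_quadratic_ext phi_bij) oddX oddq.
Qed.
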